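(* Let $M$ be a finite metric space with $n=\#M$ points and let $\sigma(M)=(\sigma_1,\ldots,\sigma_{n-1})$ be its $\operatorname{mst}$-spectrum. Then for every $k$ with $1\le k\le n-1$, $$ \sigma_k=\max\bigl\{\alpha(D):D\in\mathcal{D}_{k+1}(M)\bigr\}. $$
   Context: For a metric space, $|xy|$ denotes the distance between points $x$ and $y$; for nonempty subsets $A,B$ put $|AB|=\inf\{|ab|:a\in A,\ b\in B\}$. $\#M$ is the cardinality of $M$. Minimum spanning trees: for a finite metric space $M$, consider trees $G=(M,E)$ with vertex set exactly $M$; the length of an edge $e=vw$ is $|e|=|vw|$ and the length $|G|$ of $G$ is the sum of the lengths of its edges. A minimum spanning tree on $M$ is such a tree of the smallest possible length. $\operatorname{mst}$-spectrum: for a minimum spanning tree $G$ on $M$, let $\sigma(G)$ be the vector of the lengths of the edges of $G$, ordered descending (with multiplicity), so it has $\#M-1$ entries. This vector does not depend on the choice of the minimum spanning tree $G$, and it is called the $\operatorname{mst}$-spectrum $\sigma(M)=(\sigma_1,\ldots,\sigma_{n-1})$, $\sigma_1\ge\cdots\ge\sigma_{n-1}$, of $M$. $\mathcal{D}_k(M)$ is the family of all partitions of $M$ into $k$ nonempty subsets. For $D=\{M_1,\ldots,M_k\}\in\mathcal{D}_k(M)$ put $\alpha(D)=\min\{|M_iM_j|:i\ne j\}$. *)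

(* Defs.v *)
From HB Require Import structures.
From mathcomp Require Import all_boot all_order all_algebra.
From mathcomp Require Import all_classical all_reals all_analysis.
Set Implicit Arguments.
Unset Strict Implicit.
Unset Printing Implicit Defensive.
Import Order.TTheory GRing.Theory Num.Theory.

Local Open Scope classical_set_scope.
Local Open Scope ring_scope.

#[short(type="finMetricType")]
HB.structure Definition FinMetric (R : numDomainType) :=
  {M of Finite M & Metric R M}.

Definition is_max {R : realType} (S : set R) (m : R) : Prop :=
  S m /\ ubound S m.

Section Trees.
Context {R : realType} {M : finMetricType R}.
Implicit Types (E : {set {set M}}) (e : {set M}).

(* A simple graph on the vertex set M is given by its set E of edges, an edge
   vw being the two-element set [set v; w]. *)
Definition adj E : rel M := [rel v w | [set v; w]%SET \in E].

Definition is_tree E : Prop :=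
  [/\ (forall e, e \in E -> #|e| = 2%N),
      (forall v w, connect (adj E) v w)
    & (forall c : seq M, cycle (adj E) c -> uniq c -> (size c <= 2)%N)].

(* The value 0 is only taken on sets that are not of the form [set v; w];
   see edge_lengthE. *)
Definition edge_length e : R :=
  if [pick p : M * M | e == [set p.1; p.2]%SET] is Some p
  then mdist p.1 p.2 else 0.

Definition tree_length E : R := \sum_(e in E) edge_length e.

Definition is_mst E : Prop :=
  is_tree E /\ forall E', is_tree E' -> tree_length E <= tree_length E'.

Definition edge_lengths_desc E : seq R :=
  sort >=%O [seq edge_length e | e <- enum E].

(* s is the mst-spectrum of M. This is a predicate rather than a function of M
   because the spectrum is read off an arbitrary minimum spanning tree; such a
   tree exists by mst_exists. With s = [:: s_1; s_2; ...], the entry s_k is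
   nth 0 s k.-1. *)
Definition is_mst_spectrum (s : seq R) : Prop :=
  exists2 E, is_mst E & s = edge_lengths_desc E.

Lemma edge_lengthE (v w : M) : edge_length [set v; w]%SET = mdist v w.
Proof.
rewrite /edge_length; case: pickP => [[a b] /= /eqP h|/(_ (v, w))]; last first.
  by rewrite eqxx.
have ha : a \in [set v; w]%SET by rewrite h set21.
have hb : b \in [set v; w]%SET by rewrite h set22.
have hv : v \in [set a; b]%SET by rewrite -h set21.
have hw : w \in [set a; b]%SET by rewrite -h set22.
move: ha hb hv hw; rewrite !inE {h}.
case/orP => /eqP-> /orP[] /eqP-> // /orP[] /eqP ? /orP[] /eqP ?;
  subst=> //; exact: metric_sym.
Qed.

Let connected_graph E := [forall e in E, #|e| == 2%N] &&
  [forall v, forall w, connect (adj E) v w].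

Lemma tree_exists : exists E, is_tree E.
Proof.
have full : connected_graph [set e : {set M} | #|e| == 2%N]%SET.
  apply/andP; split; first by apply/forall_inP => e; rewrite inE.
  apply/forallP => v; apply/forallP => w.
  have [<-|vw] := eqVneq v w; first exact: connect0.
  by apply: connect1; rewrite /adj /= inE cards2 vw.
have [E /minsetP[/andP[/forall_inP E2 /forallP Ec] Emin] _] := minset_exists full.
exists E; split=> [e /E2/eqP//|v w|]; first exact: (forallP (Ec v)).
case=> [//|x [//|y [//|z p]]] cyc.
rewrite !cons_uniq => /and4P[xU yU zU _]; exfalso.
pose E' := (E :\ [set x; y])%SET.
have adj_sym (F : {set {set M}}) : symmetric (adj F).
  by move=> a b; rewrite /adj /= finset.setUC.
have xyE : [set x; y]%SET \in E by move: cyc => /= /and3P[].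
have sub : path (adj E') y (z :: rcons p x).
  move: cyc => /= /and3P[_ yz zp]; apply/andP; split.
    rewrite /adj /= !inE [_ \in E]yz andbT; apply/eqP => /finset.setP/(_ x).
    by move: xU; rewrite !inE eqxx !negb_or => /and3P[/negPf-> /negPf->].
  pose s := z :: p.
  have : {subset belast z (rcons p x) <= s} by rewrite belast_rcons.
  elim: (rcons p x) (z) zp => //= u q IH t /andP[tu uq] tq.
  rewrite IH ?andbT//; last by move=> r rq; apply: tq; rewrite inE rq orbT.
  rewrite /adj /= !inE [_ \in E]tu andbT; apply/eqP => /finset.setP/(_ t); rewrite !inE eqxx /=.
  have tzp : t \in z :: p := tq _ (mem_head _ _).
  move/esym/orP => [] /eqP tE; subst t; last by rewrite tzp in yU.
  by move: xU; rewrite inE tzp orbT.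
have yx : connect (adj E') y x.
  by apply/connectP; exists (z :: rcons p x); rewrite //= last_rcons.
have : connected_graph E'.
  apply/andP; split; first by apply/forall_inP => e /finset.setD1P[_ /E2].
  apply/forallP => v; apply/forallP => w.
  apply: (connect_sub _ (forallP (Ec v) w)) => {v w} v w vw.
  have [h|h] := eqVneq [set v; w]%SET [set x; y]%SET; last first.
    by apply: connect1; rewrite /adj /= !inE h [_ \in E]vw.
  have hv : v \in [set x; y]%SET by rewrite -h set21.
  have hw : w \in [set x; y]%SET by rewrite -h set22.
  have xy : connect (adj E') x y by rewrite (sym_connect_sym (adj_sym _)).
  by move: hv hw; rewrite !inE => /orP[] /eqP-> /orP[] /eqP->.
move=> /Emin/(_ (finset.subD1set _ _)) E'E.
by move: xyE; rewrite -E'E finset.setD11.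
Qed.

Lemma mst_exists : exists E, is_mst E.
Proof.
have [E0 treeE0] := tree_exists.
have P0 : `[< is_tree E0 >] by apply/asboolP.
case: (arg_minP (P := fun E => `[< is_tree E >]) tree_length P0).
move=> E /asboolP tE mE; exists E; split=> // E' tE'; apply: mE.
exact/asboolP.
Qed.

End Trees.

Section Partitions.
Context {R : realType} {M : finMetricType R}.
Implicit Types (A B : {set M}) (D : {set {set M}}).

Definition set_dist A B : R :=
  inf [set r | exists a b, [/\ a \in A, b \in B & r = mdist a b]].

Definition partitions (k : nat) : set {set {set M}} :=
  [set D : {set {set M}} | finset.partition D [set: M]%SET /\ #|D| = k].

(* The infimum of a finite set, nonempty as soon as D has two blocks: it is
   then a minimum, see alpha_min. *)
Definition alpha D : R :=
  inf [set r | exists A B, [/\ A \in D, B \in D, A != B & r = set_dist A B]].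

Let inf_finite (I : finType) (P : pred I) (f : I -> R) : (exists i, P i) ->
  exists2 i, P i & inf [set r | exists2 j, P j & r = f j] = f i /\
    forall j, P j -> f i <= f j.
Proof.
move=> [i0 Pi0]; case: (arg_minP f Pi0) => i Pi fi.
have lb : lbound [set r | exists2 j, P j & r = f j] (f i).
  by move=> _ [j Pj ->]; exact: fi.
exists i => //; split=> //; apply/eqP; rewrite eq_le; apply/andP; split.
  by apply: ge_inf; [exists (f i) | exists i].
by apply: lb_le_inf => //; exists (f i); exists i.
Qed.

Lemma alpha_min D : (1 < #|D|)%N ->
  exists A B, [/\ A \in D, B \in D, A != B, alpha D = set_dist A B
    & forall A' B', A' \in D -> B' \in D -> A' != B' ->
        alpha D <= set_dist A' B'].
Proof.
case/card_gt1P => A0 [B0 [A0D B0D AB0]].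
pose P (p : {set M} * {set M}) := [&& p.1 \in D, p.2 \in D & p.1 != p.2].
have [|[A B] /and3P[/= AD BD AB] [infE minE]] :=
    inf_finite (P := P) (fun p => set_dist p.1 p.2).
  by exists (A0, B0); apply/and3P.
have alphaE : alpha D = set_dist A B.
  rewrite -infE; congr (inf _); apply/seteqP; split=> r /=.
    by move=> [A' [B' [? ? ? ->]]]; exists (A', B') => //; apply/and3P.
  by move=> [[A' B'] /and3P[/= ? ? ?] ->]; exists A', B'.
exists A, B; split=> // A' B' ? ? ?; rewrite alphaE.
by apply: (minE (A', B')); apply/and3P.
Qed.

End Partitions.

(* Main.v *)
Require Import Defs.
From mathcomp Require Import all_boot all_order all_algebra.
From mathcomp Require Import all_classical all_reals all_analysis.
Import Order.TTheory GRing.Theory Num.Theory.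
Local Open Scope classical_set_scope.
Local Open Scope ring_scope.

(* Deleting k edges from a tree leaves exactly k + 1 components. A partition
   into k + 1 blocks is therefore crossed by at least k edges of a minimum
   spanning tree, each of length at least alpha D, so alpha D <= sigma_k.
   Conversely, let D consist of the components left after deleting the k longest
   edges. Two points in different components are separated in the tree by one of
   the deleted edges e, and exchanging e for the edge joining these points gives
   another spanning tree, so by minimality their distance is at least the length
   of e, which is at least sigma_k. *)

(** * Components of graphs and trees under adding and deleting edges *)

Section Components.
#[local] Set Implicit Arguments.
#[local] Unset Strict Implicit.
Context {R : realType} {M : finMetricType R}.
Implicit Types (E F : {set {set M}}) (e : {set M}) (a b v w x y : M).
Local Open Scope set_scope.

(** [n_comp] counts one canonical root per component, so the counts below are compared through maps
    between sets of roots. *)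
Definition ncomp E := n_comp (adj E) predT.

Lemma adj_sym E : symmetric (adj E).
Proof. by move=> v w; rewrite /adj /= finset.setUC. Qed.

Let csym E : connect_sym (adj E) := sym_connect_sym (adj_sym E).

Lemma connect_sub_edges E F x y :
  E \subset F -> connect (adj E) x y -> connect (adj F) x y.
Proof.
move=> /fintype.subsetP EF; apply: connect_sub => v w /EF vw; exact: connect1.
Qed.

Lemma set2_eq v w x y :
  [set x; y] = [set v; w] -> (x = v /\ y = w) \/ (x = w /\ y = v).
Proof.
move=> h.
have hx : x \in [set v; w] by rewrite -h set21.
have hy : y \in [set v; w] by rewrite -h set22.
have hv : v \in [set x; y] by rewrite h set21.
have hw : w \in [set x; y] by rewrite h set22.
move: hx hy hv hw; rewrite !inE.
by do 4!case/orP => /eqP ?; subst; auto.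
Qed.

(** A path needs the new edge at most once: in the induction, crossing back over it undoes the
    earlier crossing. *)
Lemma connect_setU1 E v w x y :
  connect (adj ([set v; w] |: E)) x y ->
  [|| connect (adj E) x y, connect (adj E) x v && connect (adj E) w y
    | connect (adj E) x w && connect (adj E) v y].
Proof.
case/connectP => p; elim: p x => [|z p IH] x /=; first by move=> _ ->; rewrite connect0.
case/andP; rewrite {1}/adj /= in_setU1 => xz zp /(IH _ zp){IH zp}.
case/orP: xz => [/eqP/set2_eq[[-> ->]|[-> ->]]|xzE].
- by case/or3P => [->|/andP[_ ->]|/andP[_ ->]]; rewrite ?connect0 ?orbT.
- by case/or3P => [->|/andP[_ ->]|/andP[_ ->]]; rewrite ?connect0 ?orbT.
have xz : connect (adj E) x z by exact: connect1.
case/or3P => [zy|/andP[zv wy]|/andP[zw vy]].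
- by rewrite (connect_trans xz zy).
- by rewrite (connect_trans xz zv) wy orbT.
- by rewrite (connect_trans xz zw) vy !orbT.
Qed.

(** An edge merges at most two components. Once the root of [w] is set aside, the other old roots
    lie in distinct components of the larger graph. *)
Lemma ncomp_setU1_le E v w : (ncomp E <= (ncomp ([set v; w] |: E)).+1)%N.
Proof.
set E1 := _ |: E.
pose A := [set x | x \in fingraph.roots (adj E)].
have -> : ncomp E = #|A| by apply: eq_card => x; rewrite !inE andbT.
rewrite (cardsD1 (fingraph.root (adj E) w)) -add1n leq_add ?leq_b1//.
have inj : {in A :\ fingraph.root (adj E) w &, injective (fingraph.root (adj E1))}.
  move=> x y; rewrite !inE => /andP[xw /eqP xr] /andP[yw /eqP yr].
  move/eqP; rewrite (root_connect (csym E1)) => /connect_setU1.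
  case/or3P => [|/andP[_]|/andP[+ _]].
  - by rewrite -(root_connect (csym E)) xr yr => /eqP.
  - by rewrite -(root_connect (csym E)) yr eq_sym (negPf yw).
  - by rewrite -(root_connect (csym E)) xr (negPf xw).
rewrite -(card_in_imset inj); apply/subset_leq_card/fintype.subsetP.
by move=> _ /imsetP[x _ ->]; rewrite !inE andbT; exact: (roots_root (csym E1)).
Qed.

(** New roots map injectively to old ones. The image misses the old root of [v] or that of [w]: two
    new roots mapped to these would be joined through the new edge, hence equal, and [v] would
    already be connected to [w]. *)
Lemma ncomp_setU1_lt E v w : ~~ connect (adj E) v w ->
  (ncomp ([set v; w] |: E) < ncomp E)%N.
Proof.
set E1 := _ |: E => vw.
pose A := [set x | x \in fingraph.roots (adj E)].
pose B := [set x | x \in fingraph.roots (adj E1)].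
have -> : ncomp E = #|A| by apply: eq_card => x; rewrite !inE andbT.
have -> : ncomp E1 = #|B| by apply: eq_card => x; rewrite !inE andbT.
have sub x y : connect (adj E) x y -> connect (adj E1) x y.
  by apply: connect_sub_edges; rewrite finset.subsetUr.
have inj : {in B &, injective (fingraph.root (adj E))}.
  move=> x y; rewrite !inE => /eqP xr /eqP yr.
  move/eqP; rewrite (root_connect (csym E)) => /sub.
  by rewrite -(root_connect (csym E1)) xr yr => /eqP.
rewrite -(card_in_imset inj); apply: proper_card; apply/properP; split.
  by apply/fintype.subsetP => _ /imsetP[x _ ->];
     rewrite inE; exact: (roots_root (csym E)).
have rA x : fingraph.root (adj E) x \in A.
  by rewrite inE; exact: (roots_root (csym E)).
have [|?] := boolP (fingraph.root (adj E) v \in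
    [set fingraph.root (adj E) x | x in B]); last first.
  by exists (fingraph.root (adj E) v).
case/imsetP => x xB vx; exists (fingraph.root (adj E) w) => //.
apply: contra vw => /imsetP[y yB wy].
move/eqP: vx; rewrite (root_connect (csym E)) => vx.
move/eqP: wy; rewrite (root_connect (csym E)) => wy.
suff xy : x = y by rewrite (connect_trans vx)// csym xy.
move: xB yB; rewrite !inE => /eqP <- /eqP <-; apply/eqP.
rewrite (root_connect (csym E1)); apply: connect_trans (sub _ _ _) _.
  by rewrite csym; exact: vx.
apply: connect_trans (sub _ _ wy); apply: connect1.
by rewrite /adj /= setU11.
Qed.

Lemma ncomp_set0 : ncomp finset.set0 = #|{: M}|.
Proof.
apply: eq_card => x; rewrite !inE andbT; apply/eqP.
have /connectP[[|y p]//= /andP[+ _]] := connect_root (adj finset.set0) x.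
by rewrite /adj /= inE.
Qed.

(** The bound [<= 1] instead of an equality covers the empty space, which has no component. *)
Lemma ncomp_le1P E :
  reflect (forall x y, connect (adj E) x y) (ncomp E <= 1)%N.
Proof.
apply: (iffP idP) => [/card_le1_eqP h x y|h].
  by rewrite -(root_connect (csym E)); apply/eqP/h;
     rewrite inE /= andbT; exact: (roots_root (csym E)).
apply/card_le1_eqP => x y; rewrite !inE !andbT => /eqP <- /eqP <-.
by apply/eqP; rewrite (root_connect (csym E)).
Qed.

(** Edges are deleted one by one, each creating at most one new component; members of [F] outside
    [E] change nothing. *)
Lemma ncomp_setD_le E F : {in F, forall e, #|e| = 2%N} ->
  (ncomp (E :\: F) <= ncomp E + #|F|)%N.
Proof.
have [n] := ubnP #|F|; elim: n F => // n IH F.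
have [->|[e eF]] := finset.set_0Vmem F; first by rewrite finset.setD0 cards0 addn0.
rewrite (cardsD1 e F) eF add1n ltnS => Fn F2.
have /eqP/cards2P[v [w [_ ee]]] := F2 _ eF.
have F2' : {in F :\ e, forall e, #|e| = 2%N}.
  by move=> f /finset.setD1P[_]; exact: F2.
rewrite addnS; apply: (@leq_trans (ncomp (E :\: (F :\ e))).+1); last first.
  by rewrite ltnS IH.
have [eE|eE] := boolP (e \in E).
  suff -> : E :\: (F :\ e) = [set v; w] |: (E :\: F) by exact: ncomp_setU1_le.
  rewrite -ee; apply/finset.setP => f; rewrite !inE.
  by have [->|] := eqVneq f e; rewrite ?eE.
suff -> : E :\: (F :\ e) = E :\: F by [].
apply/finset.setP => f; rewrite !inE.
by have [->|] := eqVneq f e; rewrite ?(negPf eE) ?andbF.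
Qed.

(** A simple path from [v] to [w] avoiding their edge has at least two steps, so the edge closes it
    to a cycle on at least three vertices. *)
Lemma tree_bridge E v w : is_tree E -> [set v; w] \in E ->
  ~~ connect (adj (E :\ [set v; w])) v w.
Proof.
move=> [E2 _ Eac] vwE; apply/negP => /connectP[p0 /shortenP[p pP pU _] wE].
have := E2 _ vwE; rewrite cards2; case: eqVneq => //= vw _.
have pE : path (adj E) v p.
  by apply: sub_path pP => x y; rewrite /adj /= !inE => /andP[].
case: p pP pU wE pE => [|y [|z p]] pP pU wE pE.
- by move: vw; rewrite wE eqxx.
- by move: wE pP => /= <-; rewrite /adj /= !inE eqxx.
have : cycle (adj E) [:: v, y, z & p].
  rewrite (cycle_path v) /= -/(path _ _ _) /= in pE *.
  by rewrite pE andbT -[last _ _]wE adj_sym.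
by move/Eac => /(_ pU).
Qed.

Lemma ncomp_tree E : is_tree E -> (0 < #|{: M}|)%N -> ncomp E = 1%N.
Proof.
move=> [_ Ec _] /card_gt0P[x _]; apply/eqP; rewrite eqn_leq; apply/andP; split.
  exact/ncomp_le1P.
apply/card_gt0P; exists (fingraph.root (adj E) x).
by rewrite !inE andbT; exact: (roots_root (csym E)).
Qed.

(** The upper bound holds in any connected graph. For the lower one, each edge is a bridge of the
    tree and hence of every subgraph containing it, so each deletion adds a component. *)
Lemma ncomp_tree_setD E F : is_tree E -> (0 < #|{: M}|)%N -> F \subset E ->
  ncomp (E :\: F) = #|F|.+1.
Proof.
move=> tE M0 FE; have [E2 _ _] := tE; apply/eqP; rewrite eqn_leq; apply/andP; split.
  rewrite -add1n -(ncomp_tree tE M0) ncomp_setD_le// => e eF.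
  exact/E2/(fintype.subsetP FE).
have [n] := ubnP #|F|; elim: n F FE => // n IH F FE.
have [->|[e eF]] := finset.set_0Vmem F.
  by rewrite finset.setD0 cards0 ncomp_tree.
rewrite (cardsD1 e F) eF add1n ltnS => Fn.
have eE : e \in E := fintype.subsetP FE _ eF.
apply: leq_ltn_trans (IH (F :\ e) _ Fn) _.
  exact: fintype.subset_trans (finset.subD1set _ _) FE.
have /eqP/cards2P[v [w [_ ee]]] := E2 _ eE.
suff -> : E :\: (F :\ e) = [set v; w] |: (E :\: F).
  apply: ncomp_setU1_lt; apply: contra (tree_bridge (v := v) (w := w) tE _).
    by apply: connect_sub_edges; rewrite finset.setDS// finset.sub1set -ee.
  by rewrite -ee.
rewrite -ee; apply/finset.setP => f; rewrite !inE.
by have [->|] := eqVneq f e; rewrite ?eE.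
Qed.

(** Deleting all edges leaves every vertex as its own component. *)
Lemma card_tree E : is_tree E -> (0 < #|{: M}|)%N -> #|{: M}| = #|E|.+1.
Proof.
move=> tE M0.
by rewrite -(ncomp_tree_setD tE M0 (subxx E)) finset.setDv ncomp_set0.
Qed.

(* A cycle would let us delete an edge and stay connected, which is impossible
   with so few edges. *)
Lemma tree_of_card E : {in E, forall e, #|e| = 2%N} ->
  (forall x y, connect (adj E) x y) -> (#|E| < #|{: M}|)%N -> is_tree E.
Proof.
move=> E2 Ec EM; split=> //.
case=> [//|x [//|y [//|z p]]] cyc.
rewrite !cons_uniq => /and4P[xU yU zU _]; exfalso.
pose E' := E :\ [set x; y].
have xyE : [set x; y] \in E by move: cyc => /= /and3P[].
(* The rest of the cycle returns from [y] to [x] without the edge [xy]: all its edges but the last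
   avoid [x], and the last avoids [y]. *)
have sub : path (adj E') y (z :: rcons p x).
  have : path (adj E) y (rcons (z :: p) x) by move: cyc => /= /andP[_].
  rewrite -rcons_cons !rcons_path => /andP[yzp lx]; apply/andP; split.
    apply: (sub_in_path (P := predC1 x)) yzp => [a b /= ax bx|].
      rewrite /adj /= in_setD1 => ->; rewrite andbT; apply/eqP => /finset.setP/(_ x).
      by rewrite !inE eqxx eq_sym (negPf ax) eq_sym (negPf bx).
    by apply/allP => t txp; apply: contraNneq xU => <-.
  rewrite /adj /= in_setD1 [_ \in E]lx andbT; apply/eqP => /finset.setP/(_ y).
  have lzp : last z p \in z :: p := mem_last z p.
  have yl : (y == last z p) = false by apply: contraNF yU => /eqP ->.
  have yx : (y == x) = false.
    by apply: contraNF xU => /eqP ->; rewrite mem_head.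
  by rewrite !inE eqxx yl yx orbT.
have yx : connect (adj E') y x.
  by apply/connectP; exists (z :: rcons p x); rewrite //= last_rcons.
have E'1 : (ncomp E' <= 1)%N.
  apply/ncomp_le1P => a b; move: (Ec a b).
  rewrite -(finset.setD1K xyE) => /connect_setU1.
  rewrite -/E'; case/or3P => // /andP[ax yb].
    by rewrite (connect_trans ax) // (connect_trans _ yb) // csym.
  by rewrite (connect_trans ax) // (connect_trans _ yb).
(* Deleting all of [E'] leaves one component per vertex, so the number of vertices is at most
   [1 + #|E'| = #|E|], a contradiction. *)
have := ncomp_setD_le E' (F := E').
rewrite finset.setDv ncomp_set0 => h.
have {h} : (#|{: M}| <= ncomp E' + #|E'|)%N.
  by apply: h => e /finset.setD1P[_]; exact: E2.
rewrite leqNgt => /negP; apply; apply: leq_trans EM.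
by rewrite (cardsD1 [set x; y] E) xyE ltnS leq_add2r.
Qed.

End Components.

(** * Edge exchange in minimum spanning trees *)

Section MinimumSpanningTrees.
Context {R : realType} {M : finMetricType R}.
Implicit Types (E F D : {set {set M}}) (e : {set M}) (a b v w x y : M).
#[local] Set Implicit Arguments.
#[local] Unset Strict Implicit.
Local Open Scope set_scope.

(** Without [e] there are two components, which the new edge joins; the number of edges does not
    grow. *)
Lemma tree_exchange E e a b : is_tree E -> e \in E ->
  ~~ connect (adj (E :\ e)) a b -> is_tree ([set a; b] |: E :\ e).
Proof.
move=> tE eE ab; have [E2 _ _] := tE.
have M0 : (0 < #|{: M}|)%N by apply/card_gt0P; exists a.
have ncE : ncomp (E :\ e) = 2%N.
  by rewrite ncomp_tree_setD ?finset.sub1set ?cards1.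
apply: tree_of_card.
- move=> f /finset.setU1P[->|/finset.setD1P[_ /E2//]].
  rewrite cards2; case: eqVneq => // ab'.
  by rewrite ab' connect0 in ab.
- by apply/ncomp_le1P; have := ncomp_setU1_lt ab; rewrite ncE.
rewrite (card_tree tE M0) ltnS (cardsD1 e E) eE.
by rewrite cardsU1 leq_add2r leq_b1.
Qed.

Lemma mst_edge_le E e a b : is_mst E -> e \in E ->
  ~~ connect (adj (E :\ e)) a b -> edge_length e <= mdist a b.
Proof.
move=> [tE minE] eE ab; have /minE := tree_exchange tE eE ab.
rewrite /tree_length (big_setD1 e eE) /= (big_setU1 [set a; b]) /=.
  by rewrite lerD2r edge_lengthE.
(* The new edge is not among the remaining ones, so its length is a separate summand and the common
   edges cancel. *)
by apply: contra ab => abE; apply: connect1.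
Qed.

(** Put the edges of [F] back one at a time. The edge [e] whose return joins [a] to [b] has one end
    connected to each of them without [e]; if [a] and [b] were connected in [E :\ e], so would be
    the ends of [e], which is a bridge. *)
Lemma tree_setD_disconnect E F a b : is_tree E -> F \subset E ->
  ~~ connect (adj (E :\: F)) a b ->
  exists2 e, e \in F & ~~ connect (adj (E :\ e)) a b.
Proof.
move=> tE; have [E2 Ec _] := tE.
have [n] := ubnP #|F|; elim: n F => // n IH F.
have [->|[e eF]] := finset.set_0Vmem F.
  by rewrite finset.setD0 Ec.
rewrite (cardsD1 e F) eF add1n ltnS => Fn FE.
have eE : e \in E := fintype.subsetP FE _ eF.
have FE' : F :\ e \subset E := fintype.subset_trans (finset.subD1set _ _) FE.
have [cab|ncab _] := boolP (connect (adj (E :\: (F :\ e))) a b); last first.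
  by have [f /finset.setD1P[_ fF] ?] := IH _ Fn FE' ncab; exists f.
move=> nab; exists e => //.
have /eqP/cards2P[v [w [_ ee]]] := E2 _ eE.
have EF : E :\: (F :\ e) = [set v; w] |: (E :\: F).
  rewrite -ee; apply/finset.setP => f; rewrite !inE.
  by have [->|] := eqVneq f e; rewrite ?eE.
have sub x y : connect (adj (E :\: F)) x y -> connect (adj (E :\ e)) x y.
  by apply: connect_sub_edges; rewrite finset.setDS// finset.sub1set.
have := tree_bridge (v := v) (w := w) tE; rewrite -ee => /(_ eE).
have csym := sym_connect_sym (adj_sym (E :\ e)).
apply: contra => eab; move: cab; rewrite EF => /connect_setU1.
rewrite (negPf nab) /= => /orP[]/andP[/sub ax /sub yb].
  rewrite csym; apply: connect_trans yb _; rewrite csym.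
  by apply: connect_trans eab; rewrite csym.
apply: connect_trans yb _; rewrite csym.
by apply: connect_trans eab; rewrite csym.
Qed.

(** * The upper bound: alpha D is at most sigma_k *)

(** With the edges contained in no block deleted, each component stays inside one block, so there
    are at least as many components as blocks. *)
Lemma crossing_edges_card E D : is_tree E -> finset.partition D [set: M] ->
  (0 < #|{: M}|)%N ->
  (#|D| <= #|[set e in E | [forall B in D, ~~ (e \subset B)]]|.+1)%N.
Proof.
move=> tE pD M0; have [E2 _ _] := tE; set F := finset _.
have FE : F \subset E by apply/fintype.subsetP => e; rewrite inE => /andP[].
rewrite -(ncomp_tree_setD tE M0 FE).
have csym := sym_connect_sym (adj_sym (E :\: F)).
have [_ trD D0] := and3P pD.
have same x y : connect (adj (E :\: F)) x y -> finset.pblock D x = finset.pblock D y.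
  case/connectP => p; elim: p x => [|z p IH] x /=; first by move=> _ ->.
  case/andP; rewrite {1}/adj /= => xzE zp /(IH _ zp) <-.
  move: xzE; rewrite !inE negb_and => /andP[/orP[/negPf-> //|+] _].
  rewrite negb_forall_in => /exists_inP[B BD]; rewrite negbK finset.subUset.
  rewrite !finset.sub1set => /andP[xB zB].
  by rewrite (def_pblock trD BD xB) (def_pblock trD BD zB).
pose A := [set x | x \in fingraph.roots (adj (E :\: F))].
have -> : ncomp (E :\: F) = #|A| by apply: eq_card => x; rewrite !inE andbT.
apply: leq_trans (leq_imset_card (finset.pblock D) A).
apply/subset_leq_card/fintype.subsetP => B BD.
have /finset.set0Pn[x xB] : B != finset.set0 by apply: contraNneq D0 => <-.
apply/imsetP; exists (fingraph.root (adj (E :\: F)) x).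
  by rewrite inE; exact: (roots_root csym).
by rewrite -(same _ _ (connect_root _ x)) (def_pblock trD BD xB).
Qed.

Lemma set_dist_le (A B : {set M}) a b :
  a \in A -> b \in B -> set_dist A B <= mdist a b.
Proof.
move=> aA bB; apply: ge_inf; last by exists a, b.
by exists 0 => _ [x [y [_ _ ->]]]; exact: mdist_ge0.
Qed.

(** Nonempty sets keep the infimum away from its default value on the empty set. *)
Lemma le_set_dist (A B : {set M}) (r : R) : A != finset.set0 -> B != finset.set0 ->
  (forall a b, a \in A -> b \in B -> r <= mdist a b) -> r <= set_dist A B.
Proof.
move=> /finset.set0Pn[a aA] /finset.set0Pn[b bB] h.
apply: lb_le_inf; first by exists (mdist a b), a, b.
by move=> _ [x [y [? ? ->]]]; exact: h.
Qed.

Lemma alpha_le_crossing D v w : finset.partition D [set: M] -> (1 < #|D|)%N ->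
  [forall B in D, ~~ ([set v; w] \subset B)] -> alpha D <= mdist v w.
Proof.
move=> pD D1 /forall_inP vw.
have [/eqP covD trD D0] := and3P pD.
have cov x : x \in finset.cover D by rewrite covD inE.
have [_ [_ [_ _ _ _ minD]]] := alpha_min D1.
have vD := pblock_mem (cov v); have wD := pblock_mem (cov w).
have vB : v \in finset.pblock D v by rewrite mem_pblock.
have wB : w \in finset.pblock D w by rewrite mem_pblock.
apply: le_trans (set_dist_le vB wB); apply: minD => //.
apply: contraNneq (vw _ vD) => vwD.
by rewrite finset.subUset !finset.sub1set vB vwD.
Qed.

(** If the entry at index [k], counted from zero, were below [r], so would be all later ones, and
    only the first [k] could reach [r]. *)
Lemma le_nth_sorted_count (s : seq R) (r : R) k : sorted >=%O s ->
  (k < count (>= r) s)%N -> r <= nth 0 s k.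
Proof.
move=> sS; apply: contraLR; rewrite -ltNge -leqNgt => skr.
rewrite -(cat_take_drop k s) count_cat.
have -> : count (>= r) (drop k s) = 0%N.
  apply/eqP; rewrite -leqn0 leqNgt -has_count; apply/hasPn => x.
  case/(nthP 0) => i; rewrite size_drop nth_drop ltn_subRL => ki <-.
  rewrite -ltNge; apply: le_lt_trans skr.
  apply: (sorted_leq_nth ge_trans ge_refl) => //; rewrite ?inE ?leq_addr//.
  exact: leq_ltn_trans (leq_addr _ _) ki.
rewrite addn0; apply: leq_trans (count_size _ _) _.
by rewrite size_take; case: ltnP.
Qed.

Lemma alpha_le_spectrum E D k : is_tree E -> (0 < k)%N ->
  partitions k.+1 D -> alpha D <= nth 0 (edge_lengths_desc E) k.-1.
Proof.
move=> tE k0 [pD cD]; have [E2 _ _] := tE.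
have M0 : (0 < #|{: M}|)%N.
  have /card_gt0P[B BD] : (0 < #|D|)%N by rewrite cD.
  have /and3P[_ _ D0] := pD.
  have /finset.set0Pn[x _] : B != finset.set0 by apply: contraNneq D0 => <-.
  by apply/card_gt0P; exists x.
apply: le_nth_sorted_count; first exact: (sort_sorted (@ge_total _ R)).
rewrite prednK//.
have := crossing_edges_card tE pD M0; rewrite cD ltnS => /leq_trans; apply.
rewrite /edge_lengths_desc count_sort count_map -size_filter cardE.
(* The crossing edges, at least [k] in number, are among the tree edges of length at least
   [alpha D]. *)
apply: uniq_leq_size; first exact: enum_uniq.
move=> e; rewrite mem_enum mem_filter inE mem_enum /= => /andP[eE De].
rewrite eE andbT; have /eqP/cards2P[v [w [_ ee]]] := E2 _ eE.
rewrite ee edge_lengthE; apply: alpha_le_crossing => //; first by rewrite cD.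
by rewrite -ee.
Qed.

(** * Attaining the bound: the longest edges and the components left without them *)

Lemma longest_edges E k : (0 < k <= #|E|)%N ->
  exists F, [/\ F \subset E, #|F| = k
    & {in F, forall e, nth 0 (edge_lengths_desc E) k.-1 <= edge_length e}].
Proof.
case/andP => k0 kE.
(* The edges themselves are sorted, so that a prefix is a set of edges while the list of lengths is
   still the descending one. *)
pose es := sort (relpre edge_length >=%O) (enum E).
have esE : edge_lengths_desc E = map edge_length es.
  by rewrite /edge_lengths_desc sort_map.
have sz : size es = #|E| by rewrite size_sort -cardE.
exists [set:: take k es]; split.
- apply/fintype.subsetP => e; rewrite inE => /mem_take.
  by rewrite mem_sort mem_enum.
- rewrite cardsE; have /card_uniqP -> : uniq (take k es).
    by rewrite take_uniq// sort_uniq enum_uniq.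
  by rewrite size_takel// sz.
move=> e; rewrite inE => /(nthP finset.set0)[i].
rewrite size_takel ?sz// => ik; rewrite nth_take// => <-.
have iE : (i < size es)%N by rewrite sz (leq_trans ik).
rewrite -(nth_map _ 0)// -esE.
apply: (sorted_leq_nth ge_trans ge_refl).
- exact: (sort_sorted (@ge_total _ R)).
- by rewrite inE esE size_map.
- by rewrite inE esE size_map sz prednK.
- by rewrite -ltnS prednK.
Qed.

Lemma components_partition E :
  let D := preim_partition (fingraph.root (adj E)) [set: M] in
  [/\ finset.partition D [set: M], #|D| = ncomp E
    & forall A B a b, A \in D -> B \in D -> A != B -> a \in A -> b \in B ->
      ~~ connect (adj E) a b].
Proof.
move=> D; have pD : finset.partition D [set: M] := preim_partitionP _ _.
have csym := sym_connect_sym (adj_sym E).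
have [/eqP covD trD D0] := and3P pD.
have cov x : x \in finset.cover D by rewrite covD inE.
(* Vertices share a root exactly when connected, so the blocks, being the fibres of the root map,
   are the components. *)
have pbE x y : (finset.pblock D x == finset.pblock D y) = connect (adj E) x y.
  rewrite -(root_connect csym) eq_pblock// /D /preim_partition.
  rewrite pblock_equivalence_partition ?inE// => u v t _ _ _.
  by split=> // /eqP ->.
split=> // [|A B a b AD BD AB aA bB]; last first.
  by rewrite -pbE (def_pblock trD AD aA) (def_pblock trD BD bB).
pose A := [set x | x \in fingraph.roots (adj E)].
have -> : ncomp E = #|A| by apply: eq_card => x; rewrite !inE andbT.
have inj : {in A &, injective (finset.pblock D)}.
  move=> x y; rewrite !inE => /eqP xr /eqP yr /eqP.
  by rewrite pbE -(root_connect csym) xr yr => /eqP.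
rewrite -(card_in_imset inj); apply: eq_card => B; apply/idP/imsetP.
  move=> BD.
  have /finset.set0Pn[x xB] : B != finset.set0 by apply: contraNneq D0 => <-.
  exists (fingraph.root (adj E) x); first by rewrite inE; exact: (roots_root csym).
  by rewrite -(def_pblock trD BD xB); apply/eqP; rewrite pbE connect_root.
by case=> x _ ->; exact: pblock_mem.
Qed.

End MinimumSpanningTrees.

Theorem theorem2p1 (R : realType) (M : finMetricType R) (s : seq R)
    (hs : is_mst_spectrum (M := M) s) (k : nat)
    (hk : (1 <= k <= #|{: M}| - 1)%N) :
  is_max [set alpha D | D in partitions (M := M) k.+1] (nth 0 s k.-1).
Proof.
have [E mE ->] := hs; have [tE _] := mE; have /andP[k0 kM] := hk.
have ub : ubound [set alpha D | D in partitions (M := M) k.+1]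
    (nth 0 (edge_lengths_desc E) k.-1).
  by move=> _ [D pD <-]; exact: alpha_le_spectrum.
split=> //.
(* Since [k] is positive, the truncated subtraction in [hk] already forces a point to exist. *)
have M0 : (0 < #|{: M}|)%N := leq_trans (leq_trans k0 kM) (leq_subr _ _).
have [|F [FE cF Fs]] := longest_edges (E := E) (k := k).
  by rewrite k0; move: kM; rewrite (card_tree tE M0) subn1.
have [pD cD disD] := components_partition (E :\: F)%SET.
set D := preim_partition _ _ in pD cD disD.
have {}cD : #|D| = k.+1 by rewrite cD ncomp_tree_setD// cF.
have DP : partitions k.+1 D by [].
exists D => //; apply/eqP; rewrite eq_le ub /=; last by exists D.
(* [alpha D] is attained at blocks [A] and [B], so it remains to bound below the distance between
   their points. *)
have [|A [B [AD BD AB -> _]]] := alpha_min (D := D); first by rewrite cD.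
have [_ _ D0] := and3P pD.
apply: le_set_dist => [||a b aA bB].
- by apply: contraNneq D0 => <-.
- by apply: contraNneq D0 => <-.
(* Some deleted edge [e] alone separates [a] from [b]; then sigma_k is at most the length of [e],
   which is at most the distance from [a] to [b]. *)
have [e eF eab] := tree_setD_disconnect tE FE (disD _ _ _ _ AD BD AB aA bB).
apply: le_trans (Fs _ eF) _; apply: mst_edge_le eab => //.
exact: (fintype.subsetP FE).
Qed.
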